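(* For all integers $n\ge1$ and $m\ge0$, the number of matchings on $[2n]$ that avoid both patterns $12312$ and $121323$ and have exactly $m$ crossings equals $$\frac{1}{n}\binom{n}{m}\binom{2n-m}{n+1}.$$
   Context: A matching on $[2n]$ is a partition of $[2n]$ into $n$ blocks of size two (edges), written $(i,j)$ with $i<j$; edges $(i,j),(i',j')$ cross if $i<i'<j<j'$ or $i'<i<j'<j$, and the number of crossings is the number of unordered pairs of crossing edges. The canonical sequential form of a matching with $n$ edges is the word of length $2n$ obtained by labeling edges $1,\dots,n$ in increasing order of initial points and writing at each position the label of the edge containing it. Words $a_1\cdots a_k$, $b_1\cdots b_k$ are order-isomorphic if $a_i<a_j\iff b_i<b_j$ for all $i,j$. A matching contains a pattern $\tau$ if its canonical sequential form has a subsequence order-isomorphic to $\tau$, and avoids $\tau$ otherwise. *)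

(* Defs.v *)
From mathcomp Require Import all_boot.

Set Implicit Arguments.
Unset Strict Implicit.
Unset Printing Implicit Defensive.

(* The ground set [2n] = {1, ..., 2n} is encoded as 'I_(2 * n) = {0, ..., 2n-1};
   every notion below depends only on the relative order of the points. *)
Definition is_matching (n : nat) (M : {set {set 'I_(2 * n)}}) : bool :=
  partition M [set: 'I_(2 * n)] && [forall e in M, #|e| == 2].

(* i and i' range over the initial points of e and f, since i < j and i' < j'
   are implied by either chain of inequalities. *)
Definition crossing (N : nat) (e f : {set 'I_N}) : bool :=
  [exists i : 'I_N, exists j : 'I_N, exists i' : 'I_N, exists j' : 'I_N,
     [&& e == [set i; j], f == [set i'; j'] &
         [&& i < i', i' < j & j < j'] || [&& i' < i, i < j' & j' < j]]].

Definition crossings (N : nat) (M : {set {set 'I_N}}) : nat :=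
  #|[set P : {set {set 'I_N}} |
       [exists e in M, exists f in M, (P == [set e; f]) && crossing e f]]|.

(* The smallest element of e; the default N is only reached when e is empty. *)
Definition initial_point (N : nat) (e : {set 'I_N}) : nat :=
  \big[minn/N]_(i in e) (i : nat).

(* The rank (starting from 1) of e among the edges of M sorted by increasing
   initial point. *)
Definition edge_label (N : nat) (M : {set {set 'I_N}}) (e : {set 'I_N}) : nat :=
  #|[set f in M | initial_point f <= initial_point e]|.

Definition canonical_form (N : nat) (M : {set {set 'I_N}}) : seq nat :=
  [seq edge_label M (pblock M i) | i <- enum 'I_N].

Definition order_isomorphic (a b : seq nat) : bool :=
  (size a == size b) &&
  [forall i : 'I_(size a), forall j : 'I_(size a),
     (nth 0 a i < nth 0 a j) == (nth 0 b i < nth 0 b j)].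

(* The subsequences of w are exactly the words mask s w, for s a bit mask of
   the same length as w. *)
Definition word_contains (w tau : seq nat) : bool :=
  [exists s : (size w).-tuple bool, order_isomorphic (mask s w) tau].

Definition avoids (N : nat) (M : {set {set 'I_N}}) (tau : seq nat) : bool :=
  ~~ word_contains (canonical_form M) tau.

(* Main.v *)
Require Import Defs.
From mathcomp Require Import all_boot all_order all_algebra.
From mathcomp Require Import zify ring.

(** Every matching arises from a smaller one by inserting a new first arc, which
    is determined by the gap where it ends. In a matching avoiding both patterns,
    such an insertion preserves avoidance for exactly the following gaps: the
    b boundaries (the gaps covered by no arc), where no crossing is created, and
    one gap in each of the b - 1 components between consecutive boundaries, where
    one crossing is created. The number of boundaries becomes each of 2, .., b + 1
    once in the first case and each of 2, .., b once in the second. The resulting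
    generating tree is that of the Schroeder paths without level step on the
    ground, crossings being level steps; multiplying their generating polynomials
    by 1 + X gives those of all Schroeder paths, whose coefficients Lagrange
    inversion expresses as products of binomials. *)

Set Implicit Arguments.
Unset Strict Implicit.
Unset Printing Implicit Defensive.

Import Order.TTheory GRing.Theory Num.Theory.

(** * Schroeder polynomials *)

Section SchroederPolynomials.

Local Open Scope ring_scope.

(* If [f] weighs the matchings by their number of boundaries, [succession f b] is
   the total weight of the children of a matching with [b] boundaries, ['X]
   marking the crossing that some of them create (see [sum_insert_arc]). *)
Definition succession (f : nat -> {poly int}) (b : nat) : {poly int} :=
  \sum_(2 <= j < b.+2) f j + 'X * \sum_(2 <= j < b.+1) f j.

Definition descendants (k : nat) : nat -> {poly int} :=
  iter k succession (fun=> 1).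

(* For [b > 0], the paths from height [b - 1] to height 0, never going below 0,
   with [n] up or level steps, the level steps being marked by ['X]. *)
Fixpoint schroeder (n b : nat) : {poly int} :=
  if n is n'.+1 then
    \sum_(0 <= j < b) (schroeder n' j.+2 + 'X * schroeder n' j.+1)
  else 1.

Lemma successionSS f b : succession f b.+2 =
  succession f b.+1 + f b.+3 + 'X * f b.+2.
Proof.
by rewrite /succession (big_nat_recr b.+3) // (big_nat_recr b.+2) //=; ring.
Qed.

Lemma descendantsS1 k : descendants k.+1 1 = descendants k 2.
Proof.
by rewrite /descendants iterS /succession big_nat1 big_geq // mulr0 addr0.
Qed.

Lemma descendantsSS k b : descendants k.+1 b.+2 =
  descendants k.+1 b.+1 + descendants k b.+3 + 'X * descendants k b.+2.
Proof. by rewrite /descendants iterS successionSS. Qed.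

Lemma schroederS0 n : schroeder n.+1 0 = 0.
Proof. exact: big_geq. Qed.

Lemma schroederSS n b : schroeder n.+1 b.+1 =
  schroeder n.+1 b + schroeder n b.+2 + 'X * schroeder n b.+1.
Proof. by rewrite -addrA [LHS]big_nat_recr. Qed.

(* The coefficientwise form of (1 + X) F G^b = G^(b+1) + X G^b, where G counts the
   Schroeder paths and F those without level step on the ground. *)
Lemma schroeder_descendants n b :
  (1 + 'X) * descendants n b.+1 = schroeder n b.+1 + 'X * schroeder n b.
Proof.
elim: n b => [|n IHn] b; first by rewrite !mulr1.
elim: b => [|b IHb].
  by rewrite descendantsS1 IHn schroederSS schroederS0; ring.
rewrite descendantsSS 2!mulrDr IHb mulrCA !IHn !schroederSS.
ring.
Qed.

End SchroederPolynomials.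

(* The recurrence [schroederSS] for the closed form of [coef_schroederS], where [x]
   stands for ['C(n.+1, d - 1)], read as 0 when [d = 0]. *)
Lemma bin_schroederS n b d x : x + 'C(n.+1, d) = 'C(n.+2, d) ->
  n.+1 * (b.+1 * 'C(n.+2, d) * 'C(2 * n.+1 + b.+2 - d, n.+1)) =
  n.+1 * (b * 'C(n.+2, d) * 'C(2 * n.+1 + b.+1 - d, n.+1)) +
  n.+2 * (b.+2 * 'C(n.+1, d) * 'C(2 * n.+1 + b.+1 - d, n) +
          b.+1 * x * 'C(2 * n.+1 + b.+1 - d, n)).
Proof.
move=> pascal; have [le_dn|lt_nd] := leqP d n.+2; last first.
  have : x + 'C(n.+1, d) = 0 by rewrite pascal bin_small.
  rewrite (bin_small lt_nd) => /eqP; rewrite addn_eq0 => /andP[/eqP-> /eqP->].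
  by rewrite !(muln0, mul0n).
have := mul_bin_down n.+2 d; rewrite -pascal.
have -> : 2 * n.+1 + b.+1 - d = n + b + (n.+2 - d).+1 by lia.
have -> : 2 * n.+1 + b.+2 - d = (n + b + (n.+2 - d).+1).+1 by lia.
move: (n.+2 - d) => e; rewrite binS.
have := mul_bin_left (n + b + e.+1) n.
have -> : n + b + e.+1 - n = b + e.+1 by lia.
move: 'C(_, n.+1) 'C(_, n) 'C(n.+1, d) => u v y /= {pascal le_dn}.
move=> /(congr1 (muln (x + y))) uv /(congr1 (muln v)) xy.
lia.
Qed.

Lemma bin_descendantsS n m :
  'C(n.+1, m.+1) * 'C(2 * n.+1 - m.+1, n.+2) +
    'C(n.+1, m) * 'C(2 * n.+1 - m, n.+2) =
  'C(n.+1, m.+1) * 'C(2 * n.+1 - m.+1, n).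
Proof.
have [lt_nm|le_mn] := ltnP n m.
  by rewrite !(@bin_small n.+1 m.+1) ?(@bin_small _ n.+2) ?muln0 //; lia.
rewrite -(subnKC le_mn); move: (n - m) => {le_mn} {}n.
have -> : 2 * (m + n).+1 - m.+1 = m + n + n.+1 by lia.
have -> : 2 * (m + n).+1 - m = (m + n + n.+1).+1 by lia.
have := mul_bin_left (m + n).+1 m.
have -> : (m + n).+1 - m = n.+1 by lia.
have := mul_bin_left (m + n + n.+1) (m + n).
rewrite addKn.
have := mul_bin_left (m + n + n.+1) (m + n).+1.
have -> : m + n + n.+1 - (m + n).+1 = n by lia.
rewrite (binS (m + n + n.+1)) => upper2 upper1 lower.
apply/eqP; rewrite -(eqn_pmul2l (ltn0Sn m)) mulnDr !mulnA lower; apply/eqP.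
transitivity ('C((m + n).+1, m) * ((m + n).+2 * 'C(m + n + n.+1, (m + n).+2) +
                                   m.+1 * 'C(m + n + n.+1, (m + n).+1))).
  by ring.
by rewrite upper2 -mulnDl (_ : n + m.+1 = (m + n).+1) ?upper1; [ring | lia].
Qed.

Section SchroederCoefficients.

Local Open Scope ring_scope.

(* Lagrange inversion: [n * schroeder n b] is [b] times the coefficient of
   [u ^ (n - 1)] in [(1 + u) ^ (n + b - 1) * (1 + u + 'X) ^ n]. *)
Lemma coef_schroederS n b d : n.+1%:R * (schroeder n.+1 b)`_d =
  (b * 'C(n.+1, d) * 'C(2 * n + b.+1 - d, n))%:R.
Proof.
elim: n b d => [|n IHn] b d.
  rewrite /= mulr1 sumr_const_nat subn0 bin0 muln1 coefMn coefD coefX coef1.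
  rewrite mul1r -natrD -mulrnA mulnC.
  by case: d => [|[|d]]; rewrite ?bin0 ?bin1 ?muln0.
elim: b => [|b IHb]; first by rewrite schroederS0 coef0 mulr0.
rewrite schroederSS !coefD coefXM.
pose x := if d == 0%N then 0%N else 'C(n.+1, d.-1).
have pascal : (x + 'C(n.+1, d) = 'C(n.+2, d))%N.
  by rewrite /x; case: (d) => [|d']; rewrite ?bin0 //= binS addnC.
have up_step : n.+1%:R * (schroeder n.+1 b.+2)`_d =
             (b.+2 * 'C(n.+1, d) * 'C(2 * n.+1 + b.+1 - d, n))%:R.
  by rewrite IHn; congr (_ * 'C(_, n))%:R; lia.
have level_step :
    n.+1%:R * (if d == 0%N then 0 else (schroeder n.+1 b.+1)`_d.-1) =
    (b.+1 * x * 'C(2 * n.+1 + b.+1 - d, n))%:R.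
  rewrite /x; case: eqP => [_|d_neq0]; first by rewrite mulr0 muln0.
  by rewrite IHn; congr (_ * 'C(_, n))%:R; lia.
apply: (@mulfI _ n.+1%:R); first by rewrite pnatr_eq0.
rewrite -natrM (bin_schroederS b pascal) natrD natrM -IHb natrM natrD -up_step.
by rewrite -level_step; ring.
Qed.

Lemma coef_descendants1 n m : n%:R * (descendants n 1)`_m =
  ('C(n, m) * 'C(2 * n - m, n.+1))%:R.
Proof.
case: n => [|n]; first by rewrite mul0r [(2 * 0 - m)%N]sub0n bin0n muln0.
have := schroeder_descendants n.+1 0.
rewrite schroederS0 mulr0 addr0 mulrDl mul1r => schroeder1E.
elim: m => [|m IHm].
  have := coef_schroederS n 1 0.
  rewrite -schroeder1E coefD coefXM addr0 => ->.
  rewrite !bin0 !mul1n -[in RHS]bin_sub; last by lia.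
  by congr 'C(_, _)%:R; lia.
apply: (@addIr _ (n.+1%:R * (descendants n.+1 1)`_m)).
have := coef_schroederS n 1 m.+1.
rewrite -schroeder1E coefD coefXM mulrDr mul1n => ->.
rewrite IHm -natrD bin_descendantsS; congr (_ * 'C(_, _))%:R; lia.
Qed.

End SchroederCoefficients.

(** * Arcs, crossings and gaps *)

(* A matching is encoded by the list whose i-th entry is the partner of i, that
   is, by an involution without fixed point; an arc is named by its opener. *)
Local Notation partner := (nth 0).

Definition is_partner_list (w : seq nat) : bool :=
  [forall i : 'I_(size w), [&& partner w i < size w,
     partner w (partner w i) == i & partner w i != i]].

Definition opens (w : seq nat) (i : nat) : bool := i < partner w i.

Definition crosses (w : seq nat) (i j : nat) : bool :=
  [&& i < j, j < partner w i & partner w i < partner w j].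

Definition crossing_number (w : seq nat) : nat :=
  \sum_(0 <= i < size w) \sum_(0 <= j < size w) crosses w i j.

(* In both patterns, i, j, k are the openers of the arcs labelled 1, 2, 3. *)
Definition contains12312 (w : seq nat) : bool :=
  [exists i : 'I_(size w), exists j : 'I_(size w), exists k : 'I_(size w),
     [&& crosses w i j, j < k < partner w i & opens w k]].

Definition contains121323 (w : seq nat) : bool :=
  [exists i : 'I_(size w), exists j : 'I_(size w), exists k : 'I_(size w),
     [&& crosses w i j, crosses w j k & partner w i < k]].

Definition avoider (w : seq nat) : bool :=
  ~~ contains12312 w && ~~ contains121323 w.

(* The gaps of w are numbered from 0 to size w, the gap p being the one just
   before the position p. *)
Definition covers (w : seq nat) (p i : nat) : bool := i < p <= partner w i.

Definition open_arcs (w : seq nat) (p : nat) : nat :=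
  \sum_(0 <= i < size w) covers w p i.

Definition boundary (w : seq nat) (p : nat) : bool :=
  [forall i : 'I_(size w), ~~ covers w p i].

Definition boundaries (w : seq nat) : seq nat :=
  [seq p <- iota 0 (size w).+1 | boundary w p].

Section Openers.

Variable w : seq nat.

Lemma opens_size i : opens w i -> i < size w.
Proof. by case: (ltnP i (size w)) => // le_i; rewrite /opens nth_default. Qed.

Lemma crosses_opens i j : crosses w i j -> opens w i && opens w j.
Proof. by rewrite /crosses /opens; lia. Qed.

Lemma covers_opens p i : covers w p i -> opens w i.
Proof. by rewrite /covers /opens; lia. Qed.

Lemma partner_listP : reflect
  (forall i, i < size w -> [/\ partner w i < size w,
     partner w (partner w i) = i & partner w i != i])
  (is_partner_list w).
Proof.
apply: (iffP forallP) => [w_inv i i_lt|w_inv i].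
  by have /and3P[? /eqP ? ?] := w_inv (Ordinal i_lt).
by have [-> -> ->] := w_inv i (ltn_ord i); rewrite eqxx.
Qed.

Lemma contains12312P : reflect
  (exists i j k, [/\ crosses w i j, j < k < partner w i & opens w k])
  (contains12312 w).
Proof.
apply: (iffP existsP) => [[i /existsP[j /existsP[k /and3P[]]]]|].
  by exists i, j, k.
case=> i [j [k [ij jk kO]]].
have /andP[/opens_size i_lt /opens_size j_lt] := crosses_opens ij.
exists (Ordinal i_lt); apply/existsP; exists (Ordinal j_lt); apply/existsP.
by exists (Ordinal (opens_size kO)); apply/and3P.
Qed.

Lemma contains121323P : reflect
  (exists i j k, [/\ crosses w i j, crosses w j k & partner w i < k])
  (contains121323 w).
Proof.
apply: (iffP existsP) => [[i /existsP[j /existsP[k /and3P[]]]]|].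
  by exists i, j, k.
case=> i [j [k [ij jk ik]]].
have /andP[/opens_size i_lt /opens_size j_lt] := crosses_opens ij.
have /andP[_ /opens_size k_lt] := crosses_opens jk.
exists (Ordinal i_lt); apply/existsP; exists (Ordinal j_lt); apply/existsP.
by exists (Ordinal k_lt); apply/and3P.
Qed.

Lemma boundaryP p : reflect (forall i, ~~ covers w p i) (boundary w p).
Proof.
apply: (iffP forallP) => [uncovered i|uncovered i]; last exact: uncovered.
apply/negP => ip; have i_lt := opens_size (covers_opens ip).
by have := uncovered (Ordinal i_lt); rewrite ip.
Qed.

Lemma not_boundaryP p : reflect (exists i, covers w p i) (~~ boundary w p).
Proof.
apply: (iffP forallPn) => [[i /negPn]|[i ip]]; first by exists i.
by exists (Ordinal (opens_size (covers_opens ip))); rewrite negbK.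
Qed.

Lemma boundary0 : boundary w 0.
Proof. by apply/boundaryP. Qed.

Lemma mem_boundaries p : (p \in boundaries w) = boundary w p && (p <= size w).
Proof. by rewrite mem_filter mem_iota. Qed.

Lemma boundary_open_arcs p : boundary w p -> open_arcs w p = 0.
Proof.
move=> /boundaryP uncovered; rewrite /open_arcs big1 // => i _.
by rewrite (negbTE (uncovered i)).
Qed.

End Openers.

Section PartnerList.

Variable w : seq nat.
Hypothesis w_inv : is_partner_list w.

Lemma partner_ltn i : i < size w -> partner w i < size w.
Proof. by case/(partner_listP w w_inv). Qed.

Lemma partnerK i : i < size w -> partner w (partner w i) = i.
Proof. by case/(partner_listP w w_inv). Qed.

Lemma partner_neq i : i < size w -> partner w i != i.
Proof. by case/(partner_listP w w_inv). Qed.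

Lemma boundary_size : boundary w (size w).
Proof.
apply/boundaryP => i; apply/negP => /andP[i_lt]; rewrite leqNgt.
by rewrite partner_ltn.
Qed.

Lemma boundary_opens a : a < size w -> boundary w a -> opens w a.
Proof.
move=> a_lt /boundaryP/(_ (partner w a)); rewrite /covers /opens partnerK //.
by have := partner_neq a_lt; lia.
Qed.

End PartnerList.

(** * Insertion of a first arc *)

Definition shift (p i : nat) : nat := (bump p i).+1.

Definition unshift (p i : nat) : nat := unbump p i.-1.

Definition insert_arc (p : nat) (w : seq nat) : seq nat :=
  p.+1 :: take p (map (shift p) w) ++ 0 :: drop p (map (shift p) w).

Arguments insert_arc : simpl never.

Lemma ltn_shift p i j : (shift p i < shift p j) = (i < j).
Proof. by rewrite /shift /bump; lia. Qed.

Lemma ltn_shiftl p i : (shift p i < p.+1) = (i < p).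
Proof. by rewrite /shift /bump; lia. Qed.

Lemma ltn_shiftr p i : (p.+1 < shift p i) = (p <= i).
Proof. by rewrite /shift /bump; lia. Qed.

Lemma shift_ltnSS N p i : p <= N -> (shift p i < N.+2) = (i < N).
Proof. by rewrite /shift /bump; lia. Qed.

Lemma shiftK p : cancel (shift p) (unshift p).
Proof. by move=> i; rewrite /unshift /= bumpK. Qed.

Variant first_arc_spec (p : nat) : nat -> Prop :=
| FirstArcOpener : first_arc_spec p 0
| FirstArcCloser : first_arc_spec p p.+1
| OldPosition i : first_arc_spec p (shift p i).

Lemma first_arcP p i : first_arc_spec p i.
Proof.
case: i => [|i]; first exact: FirstArcOpener.
have [->|ip] := eqVneq i p; first exact: FirstArcCloser.
by rewrite -(@unbumpK p i ip); apply: (OldPosition p (unbump p i)).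
Qed.

Lemma size_insert_arc p w : size (insert_arc p w) = (size w).+2.
Proof.
by rewrite /insert_arc /= size_cat /= addnS -size_cat cat_take_drop size_map.
Qed.

Lemma partner_insert_arc0 p w : partner (insert_arc p w) 0 = p.+1.
Proof. by []. Qed.

Section InsertArc.

Variables (p : nat) (w : seq nat).
Hypothesis p_le : p <= size w.

Local Notation w' := (insert_arc p w).

Lemma partner_insert_arc_closer : partner w' p.+1 = 0.
Proof.
by rewrite /insert_arc /= nth_cat size_takel ?size_map // ltnn subnn.
Qed.

Lemma partner_insert_arc i : i < size w ->
  partner w' (shift p i) = shift p (partner w i).
Proof.
move=> i_lt; rewrite /insert_arc [LHS]/= nth_cat size_takel ?size_map //.
have [ip|pi] := ltnP i p.
  have -> : bump p i = i by rewrite /bump; lia.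
  by rewrite ip nth_take // (nth_map 0).
have -> : bump p i = i.+1 by rewrite /bump; lia.
by rewrite ltnNge leqW // subSn //= nth_drop subnKC // (nth_map 0).
Qed.

Lemma opens_insert_arc_closer : opens w' p.+1 = false.
Proof. by rewrite /opens partner_insert_arc_closer. Qed.

Lemma shift_ltn_partner_insert_arc x i :
  (shift p x < partner w' (shift p i)) = (x < partner w i).
Proof.
have [i_lt|i_ge] := ltnP i (size w).
  by rewrite partner_insert_arc // ltn_shift.
by rewrite !nth_default // size_insert_arc leqNgt shift_ltnSS // -leqNgt.
Qed.

Lemma opens_insert_arc i : opens w' (shift p i) = opens w i.
Proof. exact: shift_ltn_partner_insert_arc. Qed.

Lemma crosses_insert_arc i j : crosses w' (shift p i) (shift p j) = crosses w i j.
Proof.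
rewrite /crosses ltn_shift shift_ltn_partner_insert_arc.
have [i_lt|i_ge] := ltnP i (size w).
  by rewrite partner_insert_arc // shift_ltn_partner_insert_arc.
by rewrite nth_default ?andbF.
Qed.

Lemma crosses_insert_arc0 j : crosses w' 0 (shift p j) = covers w p j.
Proof.
rewrite /crosses /covers partner_insert_arc0 ltn_shiftl.
have [j_lt|j_ge] := ltnP j (size w).
  by rewrite partner_insert_arc // ltn_shiftr.
by rewrite !nth_default ?size_insert_arc /shift /bump; lia.
Qed.

Lemma insert_arc_opensP j : opens w' j -> j = 0 \/ exists i, j = shift p i.
Proof.
case: (first_arcP p j) => [||i]; [by left| |by right; exists i].
by rewrite opens_insert_arc_closer.
Qed.

Lemma crosses_insert_arc_inv i j : crosses w' i j ->
  exists2 j', j = shift p j' &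
    (i = 0 /\ covers w p j') \/ exists2 i', i = shift p i' & crosses w i' j'.
Proof.
move=> ij; have := crosses_opens ij.
case/andP=> /insert_arc_opensP iO /insert_arc_opensP jO.
case: jO ij => [->|[j' ->]] ij; first by case/andP: ij.
exists j' => //; case: iO ij => [->|[i' ->]].
  by rewrite crosses_insert_arc0; left.
by rewrite crosses_insert_arc; right; exists i'.
Qed.

Lemma is_partner_list_insert_arc : is_partner_list w -> is_partner_list w'.
Proof.
move=> w_inv; apply/partner_listP => i; rewrite size_insert_arc.
case: (first_arcP p i) => [||{}i] i_lt.
- by rewrite partner_insert_arc0 partner_insert_arc_closer.
- by rewrite partner_insert_arc_closer partner_insert_arc0.
move: i_lt; rewrite shift_ltnSS // => i_lt.
have [t_lt tK t_neq] := partner_listP w w_inv i i_lt.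
by rewrite !partner_insert_arc // tK (can_eq (shiftK p)) shift_ltnSS.
Qed.

End InsertArc.

(** * Gaps where a new first arc can end *)

Section GoodGaps.

Variables (w : seq nat) (p : nat).

(* A new first arc closing at the gap p can only play the role of the letter 1. *)
Definition completes12312 : bool :=
  [exists j : 'I_(size w), exists k : 'I_(size w),
     [&& covers w p j, j < k < p & opens w k]].

Definition completes121323 : bool :=
  [exists j : 'I_(size w), exists k : 'I_(size w),
     [&& covers w p j, crosses w j k & p <= k]].

Lemma completes12312P : reflect
  (exists j k, [/\ covers w p j, j < k < p & opens w k]) completes12312.
Proof.
apply: (iffP existsP) => [[j /existsP[k /and3P[]]]|[j [k [pj jk kO]]]].
  by exists j, k.
exists (Ordinal (opens_size (covers_opens pj))); apply/existsP.
by exists (Ordinal (opens_size kO)); apply/and3P.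
Qed.

Lemma completes121323P : reflect
  (exists j k, [/\ covers w p j, crosses w j k & p <= k]) completes121323.
Proof.
apply: (iffP existsP) => [[j /existsP[k /and3P[]]]|[j [k [pj jk kp]]]].
  by exists j, k.
have /andP[/opens_size j_lt /opens_size k_lt] := crosses_opens jk.
exists (Ordinal j_lt); apply/existsP.
by exists (Ordinal k_lt); apply/and3P.
Qed.

Definition good_gap : bool := ~~ completes12312 && ~~ completes121323.

Lemma contains12312_insert_arc : p <= size w ->
  contains12312 (insert_arc p w) = contains12312 w || completes12312.
Proof.
move=> p_le; apply/contains12312P/orP.
  case=> i [_ [k [/(crosses_insert_arc_inv p_le)[j -> ij]]]].
  case: (first_arcP p k) => [||{}k]; rewrite ?opens_insert_arc_closer ?andbF //.
  rewrite ltn_shift opens_insert_arc // => /andP[jk + kO].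
  case: ij => [[->]|[{}i ->]].
    rewrite partner_insert_arc0 ltn_shiftl => kp pj.
    by right; apply/completes12312P; exists j, k; rewrite jk.
  rewrite shift_ltn_partner_insert_arc // => ki ij.
  by left; apply/contains12312P; exists i, j, k; rewrite jk.
case=> [/contains12312P[i [j [k [ij jk kO]]]]|].
  exists (shift p i), (shift p j), (shift p k).
  rewrite crosses_insert_arc // opens_insert_arc //.
  by rewrite ltn_shift shift_ltn_partner_insert_arc.
case/completes12312P=> j [k [pj jk kO]]; exists 0, (shift p j), (shift p k).
rewrite crosses_insert_arc0 // opens_insert_arc //.
by rewrite partner_insert_arc0 ltn_shift ltn_shiftl.
Qed.

Lemma contains121323_insert_arc : p <= size w ->
  contains121323 (insert_arc p w) = contains121323 w || completes121323.
Proof.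
move=> p_le; apply/contains121323P/orP.
  have uncross := crosses_insert_arc_inv p_le.
  case=> i [_ [_ [/uncross[j -> ij] /uncross[k ->]]]].
  case=> [[]//|[j' /(can_inj (shiftK p)) <- {j'} jk]].
  case: ij => [[-> pj]|[{}i -> ij]].
    rewrite partner_insert_arc0 ltn_shiftr => pk.
    by right; apply/completes121323P; exists j, k.
  have /andP[/opens_size i_lt _] := crosses_opens ij.
  rewrite partner_insert_arc // ltn_shift => ik.
  by left; apply/contains121323P; exists i, j, k.
case=> [/contains121323P[i [j [k [ij jk ik]]]]|].
  have /andP[/opens_size i_lt _] := crosses_opens ij.
  exists (shift p i), (shift p j), (shift p k).
  by rewrite !crosses_insert_arc // partner_insert_arc // ltn_shift.
case/completes121323P=> j [k [pj jk pk]]; exists 0, (shift p j), (shift p k).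
rewrite crosses_insert_arc0 // crosses_insert_arc //.
by rewrite partner_insert_arc0 ltn_shiftr.
Qed.

Lemma avoider_insert_arc : p <= size w ->
  avoider (insert_arc p w) = avoider w && good_gap.
Proof.
move=> p_le; rewrite /avoider contains12312_insert_arc //.
by rewrite contains121323_insert_arc // !negb_or andbACA.
Qed.

End GoodGaps.

Lemma big_nat_shift (R : Type) (idx : R) (op : Monoid.com_law idx) N p F :
  p <= N ->
  \big[op/idx]_(0 <= i < N.+2) F i =
  op (op (F 0) (F p.+1)) (\big[op/idx]_(0 <= i < N) F (shift p i)).
Proof.
move=> p_le; rewrite big_nat_recl // -Monoid.mulmA; congr (op _ _).
rewrite (@big_cat_nat _ _ _ p) //=; last exact: leqW.
rewrite [X in op _ X]big_ltn // Monoid.mulmCA; congr (op _ _).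
rewrite [RHS](@big_cat_nat _ _ _ p) //= big_add1; congr (op _ _).
  by apply: eq_big_nat => i /andP[_ ip]; rewrite /shift /bump leqNgt ip.
by apply: eq_big_nat => i /andP[pi _]; rewrite /shift /bump pi.
Qed.

Lemma crossing_number_insert_arc p w : p <= size w ->
  crossing_number (insert_arc p w) = open_arcs w p + crossing_number w.
Proof.
move=> p_le.
have closer_uncrossed i : crosses (insert_arc p w) i p.+1 = false.
  by apply/negP => /crosses_opens/andP[_]; rewrite opens_insert_arc_closer.
have closer_uncrossing j : crosses (insert_arc p w) p.+1 j = false.
  by apply/negP => /crosses_opens/andP[]; rewrite opens_insert_arc_closer.
have row i : \sum_(0 <= j < (size w).+2) crosses (insert_arc p w) i j =
             \sum_(0 <= j < size w) crosses (insert_arc p w) i (shift p j).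
  by rewrite (big_nat_shift _ _ p_le) closer_uncrossed.
rewrite /crossing_number size_insert_arc (big_nat_shift _ _ p_le) /=.
rewrite [X in _ + X + _]big1 => [|j _]; last by rewrite closer_uncrossing.
rewrite addn0 row; congr (_ + _).
  by apply: eq_bigr => j _; rewrite crosses_insert_arc0.
apply: eq_bigr => i _; rewrite row.
by apply: eq_bigr => j _; rewrite crosses_insert_arc.
Qed.

Lemma covers_insert_arc p w q i : p <= size w -> p <= q ->
  covers (insert_arc p w) q.+2 (shift p i) = covers w q i.
Proof.
move=> p_le pq; rewrite /covers.
have [i_lt|i_ge] := ltnP i (size w).
  by rewrite partner_insert_arc // /shift /bump; lia.
by rewrite !nth_default ?size_insert_arc /shift /bump; lia.
Qed.

Lemma boundary_insert_arc p w q : p <= size w -> p <= q ->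
  boundary (insert_arc p w) q.+2 = boundary w q.
Proof.
move=> p_le pq; apply/boundaryP/boundaryP => uncovered i.
  by rewrite -(covers_insert_arc _ p_le).
case: (first_arcP p i) => [||{}i].
- by rewrite /covers partner_insert_arc0; lia.
- by rewrite /covers partner_insert_arc_closer // andbF.
by rewrite covers_insert_arc.
Qed.

Lemma boundaries_insert_arc p w : p <= size w ->
  boundaries (insert_arc p w) = 0 :: [seq q.+2 | q <- boundaries w & p <= q].
Proof.
move=> p_le; rewrite /boundaries size_insert_arc -filter_predI.
have -> : (size w).+3 = 1 + (p.+1 + ((size w).+1 - p)) by lia.
have -> : (size w).+1 = p + ((size w).+1 - p) by lia.
rewrite !iotaD !filter_cat [filter _ (iota 0 1)]/= boundary0 addKn.
rewrite (@eq_in_filter _ _ pred0 (iota _ p.+1)) => [|q]; last first.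
  rewrite mem_iota => q_in; apply/negbTE/not_boundaryP.
  by exists 0; rewrite /covers partner_insert_arc0; lia.
rewrite (@eq_in_filter _ _ pred0 (iota 0 p)) => [|q]; last first.
  by rewrite mem_iota /= ltnNge => /negbTE->.
rewrite !filter_pred0 (_ : 0 + 1 + p.+1 = 2 + p) // iotaDl filter_map.
congr (_ :: map _ _); apply: eq_in_filter => q.
by rewrite mem_iota => /andP[pq _] /=; rewrite pq boundary_insert_arc.
Qed.

Definition delete_first_arc (w : seq nat) : seq nat :=
  let p := (partner w 0).-1 in
  mkseq (fun i => unshift p (partner w (shift p i))) (size w).-2.

Lemma insert_arcK p w : p <= size w -> delete_first_arc (insert_arc p w) = w.
Proof.
move=> p_le; apply: (@eq_from_nth _ 0) => [|i].
  by rewrite size_mkseq size_insert_arc.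
rewrite size_mkseq size_insert_arc => i_lt.
rewrite nth_mkseq ?size_insert_arc // partner_insert_arc0.
by rewrite partner_insert_arc // shiftK.
Qed.

Section DeleteFirstArc.

Variable w : seq nat.
Hypotheses (w_inv : is_partner_list w) (w_gt1 : 1 < size w).

Local Notation p := (partner w 0).-1.

Lemma first_closerE : partner w 0 = p.+1.
Proof. by have := partner_neq w_inv (ltnW w_gt1); lia. Qed.

Lemma first_gap_le : p <= (size w).-2.
Proof. by have := partner_ltn w_inv (ltnW w_gt1); lia. Qed.

Lemma shift_first_ltn i : (shift p i < size w) = (i < (size w).-2).
Proof. by rewrite -(shift_ltnSS _ first_gap_le); congr (_ < _); lia. Qed.

Lemma partner_delete_first_arc i : i < (size w).-2 ->
  partner w (shift p i) = shift p (partner (delete_first_arc w) i).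
Proof.
move=> i_lt; rewrite nth_mkseq //.
have := i_lt; rewrite -shift_first_ltn => /(partnerK w_inv).
case: (first_arcP p (partner w (shift p i))) => [||j _]; last by rewrite shiftK.
- by rewrite first_closerE => /eqP; rewrite /shift /bump; lia.
- by rewrite -first_closerE (partnerK w_inv (ltnW w_gt1)).
Qed.

Lemma is_partner_list_delete_first_arc : is_partner_list (delete_first_arc w).
Proof.
apply/partner_listP => i; rewrite size_mkseq => i_lt.
have := i_lt; rewrite -shift_first_ltn => /(partner_listP w w_inv)[].
rewrite partner_delete_first_arc // (can_eq (shiftK p)) shift_first_ltn => t_lt.
by rewrite partner_delete_first_arc // => /(can_inj (shiftK p)).
Qed.

Lemma delete_first_arcK : insert_arc p (delete_first_arc w) = w.
Proof.
have p_le : p <= size (delete_first_arc w) by rewrite size_mkseq first_gap_le.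
have w_size : size (insert_arc p (delete_first_arc w)) = size w.
  by rewrite size_insert_arc size_mkseq; lia.
apply: (@eq_from_nth _ 0) => [//|i]; rewrite w_size.
case: (first_arcP p i) => [_|_|{}i].
- by rewrite partner_insert_arc0 -first_closerE.
- rewrite partner_insert_arc_closer // -first_closerE.
  by rewrite (partnerK w_inv (ltnW w_gt1)).
rewrite shift_first_ltn => i_lt.
rewrite partner_insert_arc ?size_mkseq ?first_gap_le //.
by rewrite partner_delete_first_arc.
Qed.

End DeleteFirstArc.

Fixpoint partner_lists (n : nat) : seq (seq nat) :=
  if n is n'.+1 then
    [seq insert_arc p w | w <- partner_lists n', p <- iota 0 (size w).+1]
  else [:: [::]].

Lemma mem_partner_lists n w :
  (w \in partner_lists n) = (size w == 2 * n) && is_partner_list w.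
Proof.
elim: n w => [|n IHn] w.
  by rewrite inE; case: w => //=; apply/esym/forallP => -[].
apply/allpairsPdep/andP => [[v [p [+ + ->]]]|[/eqP size_w w_inv]].
  rewrite IHn mem_iota => /andP[/eqP size_v v_inv] p_le.
  by rewrite size_insert_arc size_v mulnS is_partner_list_insert_arc.
have w_gt1 : 1 < size w by lia.
exists (delete_first_arc w), (partner w 0).-1; split.
- by rewrite IHn size_mkseq size_w mulnS eqxx is_partner_list_delete_first_arc.
- by rewrite mem_iota size_mkseq ltnS first_gap_le.
- by rewrite delete_first_arcK.
Qed.

Lemma uniq_partner_lists n : uniq (partner_lists n).
Proof.
elim: n => // n IHn.
apply: allpairs_uniq_dep => // [w _|]; first exact: iota_uniq.
move=> _ _ /allpairsPdep[v [p [_ + ->]]] /allpairsPdep[v' [p' [_ + ->]]].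
rewrite !mem_iota /= => p_le p'_le eq_ins.
have [Ep] : p.+1 = p'.+1 by have /(congr1 (head 0)) := eq_ins.
by rewrite -(insert_arcK p_le) -(insert_arcK p'_le) eq_ins Ep.
Qed.

Lemma boundary_good_gap w p : boundary w p -> good_gap w p.
Proof.
move=> /boundaryP uncovered; apply/andP; split; apply/negP.
  by case/completes12312P=> j [k []]; rewrite (negbTE (uncovered j)).
by case/completes121323P=> j [k []]; rewrite (negbTE (uncovered j)).
Qed.

Lemma good_gap_no12312 w p j k :
  good_gap w p -> covers w p j -> j < k < p -> ~~ opens w k.
Proof.
case/andP=> no_pattern _ pj jk; apply: contra no_pattern => kO.
by apply/completes12312P; exists j, k.
Qed.

Lemma good_gap_no121323 w p j k :
  good_gap w p -> covers w p j -> p <= k -> ~~ crosses w j k.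
Proof.
case/andP=> _ no_pattern pj pk; apply: contra no_pattern => jk.
by apply/completes121323P; exists j, k.
Qed.

Lemma good_gap_covers_uniq w p i j :
  good_gap w p -> covers w p i -> covers w p j -> i = j.
Proof.
move=> gp pi pj; have iO := covers_opens pi; have jO := covers_opens pj.
move: (pi) (pj) => /andP[ip _] /andP[jp _].
case: (ltngtP i j) => // [ij|ji].
  by have := good_gap_no12312 gp pi (k := j); rewrite ij jp jO => /(_ isT).
by have := good_gap_no12312 gp pj (k := i); rewrite ji ip iO => /(_ isT).
Qed.

Lemma good_gap_open_arcs w p :
  good_gap w p -> ~~ boundary w p -> open_arcs w p = 1.
Proof.
move=> gp /not_boundaryP[i pi]; have i_lt := opens_size (covers_opens pi).
rewrite /open_arcs big_mkord (bigD1 (Ordinal i_lt)) //= pi big1 // => j ji.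
apply/eqP; rewrite eqb0; apply: contra ji => pj.
by apply/eqP/val_inj; apply: good_gap_covers_uniq gp pj pi.
Qed.

Lemma sum_rank (V : nmodType) (h : nat -> V) (s : seq nat) : sorted ltn s ->
  (\sum_(a <- s) h (count (ltn a) s) = \sum_(0 <= j < size s) h j)%R.
Proof.
elim: s => [|x s IHs]; first by rewrite big_nil big_geq.
rewrite /= path_sortedE => [/andP[x_lt /IHs{}IHs]|]; last exact: ltn_trans.
have := x_lt; rewrite all_count big_cons ltnn => /eqP->.
rewrite big_nat_recr //= -IHs addrC; congr (_ + _)%R.
by apply: eq_big_seq => a /(allP x_lt)/ltnW xa; rewrite /= ltnNge xa.
Qed.

Lemma count_leq_mem (s : seq nat) a : uniq s -> a \in s ->
  count (leq a) s = (count (ltn a) s).+1.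
Proof.
move=> s_uniq a_s; have := count_predUI (pred1 a) (ltn a) s.
rewrite (count_uniq_mem a s_uniq) a_s add1n => <-.
rewrite [X in _ + X](eq_count (a2 := pred0)) => [|b] /=; last by case: ltngtP.
rewrite count_pred0 addn0; apply: eq_count => b /=.
by rewrite leq_eqVlt eq_sym.
Qed.

(** * The good gaps of an avoider *)

Section Sites.

Variable w : seq nat.
Hypotheses (w_inv : is_partner_list w) (w_av : avoider w).

Lemma avoider_no12312 i j k :
  crosses w i j -> j < k < partner w i -> ~~ opens w k.
Proof.
case/andP: w_av => no_pattern _ ij jk; apply: contra no_pattern => kO.
by apply/contains12312P; exists i, j, k.
Qed.

Lemma avoider_no121323 i j k :
  crosses w i j -> partner w i < k -> ~~ crosses w j k.
Proof.
case/andP: w_av => _ no_pattern ij ik; apply: contra no_pattern => jk.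
by apply/contains121323P; exists i, j, k.
Qed.

Lemma good_gap_covers_partner p i k :
  good_gap w p -> covers w p i -> i < k < p -> covers w k (partner w k).
Proof.
move=> p_good pi ik; have := good_gap_no12312 p_good pi ik.
have /andP[_ p_le] := pi; have i_size := opens_size (covers_opens pi).
have k_size : k < size w by have := partner_ltn w_inv i_size; lia.
rewrite /opens /covers partnerK // leqnn andbT -leqNgt leq_eqVlt.
by rewrite (negbTE (partner_neq w_inv k_size)).
Qed.

Section Component.

Variable a : nat.
Hypotheses (a_lt : a < size w) (a_bd : boundary w a).

Let a_opens : a < partner w a := boundary_opens w_inv a_lt a_bd.

Let a_partnerK : partner w (partner w a) = a := partnerK w_inv a_lt.

(* The unique gap of the component starting at a where a new first arc can end
   while crossing an old arc. *)
Definition site : nat :=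
  if [exists j : 'I_(size w), crosses w a j] then (partner w a).+1 else a.+1.

Variant site_spec : nat -> Type :=
| SiteCrossed j of crosses w a j : site_spec (partner w a).+1
| SiteUncrossed of (forall j, ~~ crosses w a j) : site_spec a.+1.

Lemma siteP : site_spec site.
Proof.
rewrite /site; case: existsP => [crossed|uncrossed].
  by have [j aj] := sigW crossed; apply: SiteCrossed aj.
apply: SiteUncrossed => j; apply/negP => aj; apply: uncrossed.
by have /andP[_ /opens_size j_lt] := crosses_opens aj; exists (Ordinal j_lt).
Qed.

Lemma covers_ge p i : a < p -> covers w p i -> a <= i.
Proof.
move/boundaryP: a_bd => /(_ i); rewrite /covers; lia.
Qed.

Lemma crossing_arc_uniq i j : crosses w a i -> crosses w a j -> i = j.
Proof.
move=> ai aj; have /andP[_ iO] := crosses_opens ai.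
have /andP[_ jO] := crosses_opens aj.
move: (ai) (aj) => /and3P[_ i_lt _] /and3P[_ j_lt _].
case: (ltngtP i j) => // [ij|ji].
  by have := avoider_no12312 ai (k := j); rewrite ij j_lt jO => /(_ isT).
by have := avoider_no12312 aj (k := i); rewrite ji i_lt iO => /(_ isT).
Qed.

Lemma covers_closer_crosses i : covers w (partner w a).+1 i -> crosses w a i.
Proof.
move=> ci; have := covers_ge (leqW a_opens) ci.
move: ci; rewrite /covers /crosses ltnS => /andP[i_le i_gt] a_le.
have i_neq : i != partner w a.
  by apply: contraTneq i_gt => ->; rewrite a_partnerK -leqNgt ltnW.
have a_neq : a != i by apply: contraTneq i_gt => <-; rewrite ltnn.
by rewrite i_gt andbT !ltn_neqAle a_neq a_le i_neq i_le.
Qed.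

Lemma site_bounds : a < site <= size w.
Proof.
by have := partner_ltn w_inv a_lt; case: siteP => *; lia.
Qed.

Lemma site_not_boundary q : a < q <= site -> ~~ boundary w q.
Proof.
move=> /andP[aq q_le]; apply/not_boundaryP.
have [qa|qa] := leqP q (partner w a).
  by exists a; rewrite /covers aq.
move: q_le; case: siteP => [j /and3P[_ ja aj]|_] q_le; last by lia.
by exists j; rewrite /covers; lia.
Qed.

Lemma site_good : good_gap w site.
Proof.
case: siteP => [j aj|uncrossed]; apply/andP; split; apply/negP.
- case/completes12312P=> i [k [/covers_closer_crosses ai /andP[ik k_le] kO]].
  move: ik; rewrite (crossing_arc_uniq ai aj) => jk.
  have k_neq : k != partner w a.
    by apply: contraTneq kO => ->; rewrite /opens a_partnerK -leqNgt ltnW.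
  have := avoider_no12312 aj (k := k).
  by rewrite jk kO ltn_neqAle k_neq -ltnS k_le => /(_ isT).
- case/completes121323P=> i [k [/covers_closer_crosses ai ik ak]].
  move: ik; rewrite (crossing_arc_uniq ai aj).
  by rewrite (negbTE (avoider_no121323 aj ak)).
- case/completes12312P=> i [k [/(covers_ge (leqnn _)) ai ik _]].
  by move: ik; lia.
case/completes121323P=> i [k [ci ik _]]; have ai := covers_ge (leqnn _) ci.
have Ei : i = a by apply/eqP; rewrite eqn_leq ai andbT; case/andP: ci.
by move: ik; rewrite Ei (negbTE (uncrossed k)).
Qed.

Section GoodGapOfComponent.

Variable p : nat.
Hypotheses (p_gt : a < p) (p_le : p <= size w) (p_good : good_gap w p).
Hypothesis p_inner : forall q, a < q <= p -> ~~ boundary w q.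

Lemma crossed_good_gap_gt j : crosses w a j -> partner w a < p.
Proof.
move=> aj; have /andP[_ jO] := crosses_opens aj; have /and3P[a_lt_j _ _] := aj.
rewrite ltnNge; apply/negP => p_le_a.
have pa : covers w p a by rewrite /covers p_gt.
have [jp|pj] := ltnP j p; last first.
  by have := good_gap_no121323 p_good pa pj; rewrite aj.
have := good_gap_no12312 p_good pa (k := j).
by rewrite a_lt_j jp jO => /(_ isT).
Qed.

Lemma crossed_good_gap_le j : crosses w a j -> p <= (partner w a).+1.
Proof.
move=> aj; have /andP[_ jO] := crosses_opens aj; have /and3P[_ ja j_gt] := aj.
have uniq_cover i : covers w (partner w a).+1 i -> i = j.
  by move=> /covers_closer_crosses ai; apply: crossing_arc_uniq aj.
rewrite leqNgt; apply/negP => p_gt_next.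
have [p_le_j|j_lt_p] := leqP p (partner w j).
  have pj : covers w p j by rewrite /covers p_le_j andbT; lia.
  have next_j : covers w (partner w a).+1 (partner w (partner w a).+1).
    by apply: good_gap_covers_partner p_good pj _; lia.
  have next_size : (partner w a).+1 < size w by apply: leq_trans p_gt_next p_le.
  move: p_le_j; rewrite -(uniq_cover _ next_j) (partnerK w_inv next_size).
  by rewrite leqNgt p_gt_next.
have /not_boundaryP[d] : ~~ boundary w (partner w j).+1 by apply: p_inner; lia.
rewrite /covers ltnS => /andP[d_le d_gt].
have [d_le_a|d_gt_a] := leqP d (partner w a).
  have d_j : d = j by apply: uniq_cover; rewrite /covers; lia.
  by move: d_gt; rewrite d_j ltnn.
have d_neq : d != partner w j.
  apply: contraTneq d_gt => ->.
  by rewrite (partnerK w_inv (opens_size jO)); lia.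
have jd : crosses w j d.
  by rewrite /crosses (ltn_trans ja d_gt_a) d_gt ltn_neqAle d_neq d_le.
by have := avoider_no121323 aj d_gt_a; rewrite jd.
Qed.

Lemma uncrossed_good_gap_le_closer :
  (forall j, ~~ crosses w a j) -> p <= partner w a.
Proof.
move=> uncrossed; rewrite leqNgt; apply/negP => ap.
have /not_boundaryP[d /covers_closer_crosses] : ~~ boundary w (partner w a).+1.
  by apply: p_inner; rewrite ltnS ltnW.
by rewrite (negbTE (uncrossed d)).
Qed.

Lemma uncrossed_good_gap_le : (forall j, ~~ crosses w a j) -> p <= a.+1.
Proof.
move=> /uncrossed_good_gap_le_closer p_le_a.
rewrite leqNgt; apply/negP => p_gt_next.
have pa : covers w p a by rewrite /covers p_gt.
have next_a : covers w a.+1 (partner w a.+1).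
  by apply: good_gap_covers_partner p_good pa _; rewrite ltnSn.
have partner_next : partner w a.+1 = a.
  apply/eqP; rewrite eqn_leq (covers_ge _ next_a) // andbT.
  by case/andP: next_a.
have next_size : a.+1 < size w by apply: leq_trans p_gt_next p_le.
move: p_le_a; rewrite -{1}partner_next (partnerK w_inv next_size).
by rewrite leqNgt p_gt_next.
Qed.

Lemma good_gap_eq_site : p = site.
Proof.
apply/eqP; rewrite eqn_leq; case: siteP => [j aj|uncrossed].
  by rewrite (crossed_good_gap_le aj) (crossed_good_gap_gt aj).
by rewrite uncrossed_good_gap_le.
Qed.

End GoodGapOfComponent.

End Component.

Lemma last_boundary p : ~~ boundary w p ->
  exists a, [/\ a < p, boundary w a & forall q, a < q <= p -> ~~ boundary w q].
Proof.
move=> p_nbd; have ex_bd : exists a, boundary w a && (a <= p).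
  by exists 0; rewrite boundary0.
have bd_le a : boundary w a && (a <= p) -> a <= p by case/andP.
case: (ex_maxnP ex_bd bd_le) => a /andP[a_bd a_le] a_max; exists a; split=> //.
  by rewrite ltn_neqAle a_le andbT; apply: contraNneq p_nbd => <-.
move=> q /andP[aq qp]; apply/negP => q_bd.
by have := a_max q; rewrite q_bd qp => /(_ isT); rewrite leqNgt aq.
Qed.

Definition inner_boundaries : seq nat :=
  [seq a <- iota 0 (size w) | boundary w a].

Lemma boundaries_rcons : boundaries w = rcons inner_boundaries (size w).
Proof.
rewrite /boundaries -addn1 iotaD filter_cat /= add0n.
by rewrite (boundary_size w_inv) cats1.
Qed.

Lemma mem_inner_boundaries a :
  (a \in inner_boundaries) = boundary w a && (a < size w).
Proof. by rewrite mem_filter mem_iota. Qed.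

Lemma site_inj : {in inner_boundaries &, injective site}.
Proof.
suff site_lt a b : a \in inner_boundaries -> b \in inner_boundaries ->
    a < b -> site a != site b.
  move=> a b a_in b_in E; case: (ltngtP a b) => // [ab|ba].
    by have := site_lt a b a_in b_in ab; rewrite E eqxx.
  by have := site_lt b a b_in a_in ba; rewrite E eqxx.
rewrite !mem_inner_boundaries => /andP[a_bd a_lt] /andP[b_bd b_lt] ab.
have /andP[b_site _] := site_bounds b_lt b_bd.
apply: contraTneq b_bd => E; apply: (site_not_boundary a_lt a_bd).
by rewrite ab E ltnW.
Qed.

Lemma perm_sites :
  perm_eq [seq p <- iota 0 (size w).+1 | good_gap w p && ~~ boundary w p]
          [seq site a | a <- inner_boundaries].
Proof.
apply: uniq_perm; first by rewrite filter_uniq ?iota_uniq.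
  by rewrite (map_inj_in_uniq site_inj) filter_uniq ?iota_uniq.
move=> p; rewrite mem_filter mem_iota ltnS; apply/andP/mapP => [[]|[a]].
  move=> /andP[p_good p_nbd] p_le.
  have [a [a_lt a_bd inner]] := last_boundary p_nbd.
  have a_size : a < size w by apply: leq_trans p_le.
  exists a; first by rewrite mem_inner_boundaries a_bd.
  exact: good_gap_eq_site.
rewrite mem_inner_boundaries => /andP[a_bd a_size] ->.
have /andP[a_lt site_le] := site_bounds a_size a_bd.
by rewrite site_good // (site_not_boundary a_size a_bd) ?a_lt ?leqnn.
Qed.

Lemma boundaries_sorted : sorted ltn (boundaries w).
Proof. by rewrite sorted_filter ?iota_ltn_sorted //; apply: ltn_trans. Qed.

Lemma inner_boundaries_sorted : sorted ltn inner_boundaries.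
Proof. by rewrite sorted_filter ?iota_ltn_sorted //; apply: ltn_trans. Qed.

Section SumGoodGaps.

Variables (V : nmodType) (f : nat -> nat -> V).

Local Open Scope ring_scope.

Lemma sum_boundary_gaps :
  \sum_(p <- boundaries w)
     f (open_arcs w p) (size (boundaries (insert_arc p w))) =
  \sum_(2 <= j < (size (boundaries w)).+2) f 0 j.
Proof.
rewrite 2!big_add1 -(sum_rank _ boundaries_sorted); apply: eq_big_seq => p p_in.
move: (p_in); rewrite mem_boundaries => /andP[p_bd p_le].
rewrite boundary_open_arcs // boundaries_insert_arc //= size_map size_filter.
by rewrite count_leq_mem // filter_uniq ?iota_uniq.
Qed.

Lemma sum_inner_good_gaps :
  \sum_(p <- iota 0 (size w).+1 | good_gap w p && ~~ boundary w p)
     f (open_arcs w p) (size (boundaries (insert_arc p w))) =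
  \sum_(2 <= j < (size (boundaries w)).+1) f 1 j.
Proof.
rewrite -big_filter (perm_big _ perm_sites) big_map boundaries_rcons.
rewrite size_rcons 2!big_add1 -(sum_rank _ inner_boundaries_sorted).
apply: eq_big_seq => a; rewrite mem_inner_boundaries => /andP[a_bd a_size].
have /andP[a_lt site_le] := site_bounds a_size a_bd.
rewrite good_gap_open_arcs ?site_good //; last first.
  by rewrite (site_not_boundary a_size a_bd) // a_lt leqnn.
rewrite boundaries_insert_arc //= size_map size_filter.
transitivity (f 1 (count (ltn a) (boundaries w)).+1); last first.
  by rewrite boundaries_rcons -cats1 count_cat /= a_size addn1.
congr (f _ _.+1); apply: eq_in_count => q.
rewrite mem_boundaries => /andP[q_bd _].
apply/idP/idP => /= [|aq]; first exact: leq_trans.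
rewrite leqNgt; apply: contraL q_bd => q_lt.
by apply: (site_not_boundary a_size a_bd); rewrite aq ltnW.
Qed.

Lemma sum_good_gaps :
  \sum_(p <- iota 0 (size w).+1 | good_gap w p)
     f (open_arcs w p) (size (boundaries (insert_arc p w))) =
  \sum_(2 <= j < (size (boundaries w)).+2) f 0 j +
  \sum_(2 <= j < (size (boundaries w)).+1) f 1 j.
Proof.
rewrite (bigID (boundary w)) /= -sum_boundary_gaps -sum_inner_good_gaps.
congr (_ + _); rewrite big_filter; apply: eq_bigl => p.
by apply: andb_idl; apply: boundary_good_gap.
Qed.

End SumGoodGaps.

End Sites.

(** * The generating tree *)

Section GeneratingTree.

Local Open Scope ring_scope.

Lemma sum_insert_arc w f : is_partner_list w -> avoider w ->
  \sum_(p <- iota 0 (size w).+1 | avoider (insert_arc p w))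
     'X^(crossing_number (insert_arc p w)) *
       f (size (boundaries (insert_arc p w))) =
  'X^(crossing_number w) * succession f (size (boundaries w)).
Proof.
move=> w_inv w_av; transitivity ('X^(crossing_number w) *
  \sum_(p <- iota 0 (size w).+1 | good_gap w p)
     'X^(open_arcs w p) * f (size (boundaries (insert_arc p w)))).
  rewrite mulr_sumr big_seq_cond [RHS]big_seq_cond; apply: eq_big => p.
    rewrite mem_iota add0n ltnS leq0n; case: leqP => //= p_le.
    by rewrite avoider_insert_arc // w_av.
  rewrite mem_iota => /andP[p_le _].
  by rewrite crossing_number_insert_arc // addnC exprD mulrA.
rewrite (sum_good_gaps w_inv w_av (fun c b => 'X^c * f b)).
rewrite /succession mulr_sumr.
by under eq_bigr do rewrite mul1r.
Qed.

Lemma sum_avoidersS n f :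
  \sum_(w <- partner_lists n.+1 | avoider w)
     'X^(crossing_number w) * f (size (boundaries w)) =
  \sum_(w <- partner_lists n | avoider w)
     'X^(crossing_number w) * succession f (size (boundaries w)).
Proof.
rewrite big_mkcond big_allpairs_dep [RHS]big_mkcond big_seq [RHS]big_seq.
apply: eq_bigr => w; rewrite mem_partner_lists => /andP[_ w_inv].
rewrite -big_mkcond; case: ifPn => [w_av|w_nav]; first exact: sum_insert_arc.
rewrite big_seq_cond big1 // => p; rewrite mem_iota => /andP[p_le].
by rewrite avoider_insert_arc // (negbTE w_nav).
Qed.

Lemma avoider_nil : avoider [::].
Proof. by apply/andP; split; apply/existsP => -[[]]. Qed.

Lemma sum_avoiders n f :
  \sum_(w <- partner_lists n | avoider w)
     'X^(crossing_number w) * f (size (boundaries w)) = iter n succession f 1.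
Proof.
elim: n f => [|n IHn] f; last by rewrite sum_avoidersS IHn -iterSr.
rewrite big_cons big_nil avoider_nil /crossing_number big_geq // mul1r addr0.
by rewrite /boundaries /= boundary0.
Qed.

Lemma count_avoiders n m :
  (count (fun w => avoider w && (crossing_number w == m)) (partner_lists n))%:R =
  (descendants n 1)`_m.
Proof.
rewrite /descendants -sum_avoiders coef_sum -sum1_count natr_sum big_mkcondr.
by apply: eq_bigr => w _; rewrite mulr1 coefXn eq_sym; case: eqP.
Qed.

End GeneratingTree.

(** * Patterns and crossings of a matching *)

Lemma initial_point_set2 N (i j : 'I_N) : initial_point [set i; j] = minn i j.
Proof.
transitivity (Order.min (Order.min (i : nat) N) (Order.min (j : nat) N)).
  by rewrite -!bigmin_set1 -bigminU.
by rewrite !minEnat !(minn_idPl (ltnW (ltn_ord _))).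
Qed.

Lemma edge_label_ltn N (M : {set {set 'I_N}}) e f : f \in M ->
  (edge_label M e < edge_label M f) = (initial_point e < initial_point f).
Proof.
move=> fM; rewrite /edge_label; case: (ltnP (initial_point e)) => ef.
  apply: proper_card; apply/properP; split.
    apply/subsetP => g; rewrite !inE => /andP[-> /leq_trans->] //.
    exact: ltnW.
  by exists f; rewrite !inE fM ?leqnn // -ltnNge.
apply/negbTE; rewrite -leqNgt; apply: subset_leq_card; apply/subsetP => g.
by rewrite !inE => /andP[-> /leq_trans->].
Qed.

Lemma order_isomorphicP (a b : seq nat) : reflect
  (size a = size b /\ forall i j, i < size a -> j < size a ->
     (nth 0 a i < nth 0 a j) = (nth 0 b i < nth 0 b j))
  (order_isomorphic a b).
Proof.
apply: (iffP andP) => [[/eqP size_ab /forallP iso]|[size_ab iso]]; split=> //.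
- move=> i j i_lt j_lt.
  by have /forallP/(_ (Ordinal j_lt))/eqP := iso (Ordinal i_lt).
- exact/eqP.
by apply/forallP=> i; apply/forallP=> j; apply/eqP/iso.
Qed.

Lemma eq_in_order_isomorphic (f g : nat -> nat) (s tau : seq nat) :
  {in s &, forall x y, (f x < f y) = (g x < g y)} ->
  order_isomorphic (map f s) tau = order_isomorphic (map g s) tau.
Proof.
move=> eq_fg; have nth_fg i j : i < size s -> j < size s ->
    (nth 0 (map f s) i < nth 0 (map f s) j) =
    (nth 0 (map g s) i < nth 0 (map g s) j).
  by move=> i_lt j_lt; rewrite !(nth_map 0) // eq_fg ?mem_nth.
apply/order_isomorphicP/order_isomorphicP; rewrite !size_map => -[size_s iso].
  by split=> // i j i_lt j_lt; rewrite -nth_fg ?iso.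
by split=> // i j i_lt j_lt; rewrite nth_fg ?iso.
Qed.

Lemma mask_map_nth (w : seq nat) (s : bitseq) :
  mask s w = map (nth 0 w) (mask s (iota 0 (size w))).
Proof. by rewrite map_mask map_nth_iota0 // take_size. Qed.

Lemma word_containsP (w tau : seq nat) : reflect
  (exists ps, [/\ sorted ltn ps, all (gtn (size w)) ps &
                  order_isomorphic (map (nth 0 w) ps) tau])
  (word_contains w tau).
Proof.
apply: (iffP existsP) => [[s iso]|[ps [ps_sorted ps_lt iso]]].
  exists (mask s (iota 0 (size w))); rewrite -mask_map_nth iso; split=> //.
    apply: (subseq_sorted ltn_trans (mask_subseq _ _)); apply: iota_ltn_sorted.
  by apply/allP => p /mem_mask; rewrite mem_iota.
have size_mask : size (map (mem ps) (iota 0 (size w))) == size w.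
  by rewrite size_map size_iota.
exists (Tuple size_mask); rewrite mask_map_nth -filter_mask.
rewrite (_ : filter _ _ = ps) //.
apply: (irr_sorted_eq ltn_trans ltnn) => // [|p].
  by apply: sorted_filter; [apply: ltn_trans | apply: iota_ltn_sorted].
by rewrite mem_filter mem_iota andb_idr // => /(allP ps_lt).
Qed.

Lemma order_isomorphic_12312 a b c d e :
  order_isomorphic [:: a; b; c; d; e] [:: 1; 2; 3; 1; 2] =
  [&& a == d, b == e, a < b & b < c].
Proof.
apply/order_isomorphicP/and4P => [[_ iso]|[/eqP<- /eqP<- ab bc]].
  have := (iso 0 3 isT isT, iso 3 0 isT isT, iso 1 4 isT isT).
  have := (iso 4 1 isT isT, iso 0 1 isT isT, iso 1 2 isT isT).
  by move=> /= [[? ?] ?] [[? ?] ?]; split; lia.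
split=> // i j.
by case: i => [|[|[|[|[|i]]]]] //; case: j => [|[|[|[|[|j]]]]] //= _ _; lia.
Qed.

Lemma order_isomorphic_121323 a b c d e f :
  order_isomorphic [:: a; b; c; d; e; f] [:: 1; 2; 1; 3; 2; 3] =
  [&& a == c, b == e, d == f, a < b & b < d].
Proof.
apply/order_isomorphicP/and5P => [[_ iso]|[/eqP<- /eqP<- /eqP<- ab bd]].
  have := (iso 0 2 isT isT, iso 2 0 isT isT, iso 1 4 isT isT, iso 4 1 isT isT).
  have := (iso 3 5 isT isT, iso 5 3 isT isT, iso 0 1 isT isT, iso 1 3 isT isT).
  by move=> /= [[[? ?] ?] ?] [[[? ?] ?] ?]; split; lia.
split=> // i j.
case: i => [|[|[|[|[|[|i]]]]]] //.
all: by case: j => [|[|[|[|[|[|j]]]]]] //= _ _; lia.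
Qed.

Definition partner_ord N (w : seq nat) (i : 'I_N) : 'I_N :=
  insubd i (partner w i).

Definition arc N (w : seq nat) (i : 'I_N) : {set 'I_N} :=
  [set i; partner_ord w i].

Definition matching_of N (w : seq nat) : {set {set 'I_N}} :=
  [set arc w i | i : 'I_N].

Definition opener (w : seq nat) (i : nat) : nat := minn i (partner w i).

Section MatchingOf.

Variables (N : nat) (w : seq nat).
Hypotheses (w_size : size w = N) (w_inv : is_partner_list w).

Local Notation t := (@partner_ord N w).
Local Notation arc := (@arc N w).
Local Notation M := (matching_of N w).

Lemma ord_ltn_size (i : 'I_N) : i < size w.
Proof. by rewrite w_size. Qed.

Lemma partner_ordE (i : 'I_N) : t i = partner w i :> nat.
Proof.
by rewrite val_insubd -[X in _ < X]w_size partner_ltn ?ord_ltn_size.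
Qed.

Lemma partner_ordK : involutive t.
Proof.
by move=> i; apply: val_inj; rewrite /= !partner_ordE partnerK ?ord_ltn_size.
Qed.

Lemma partner_ord_neq (i : 'I_N) : t i != i.
Proof.
by rewrite -(inj_eq val_inj) /= partner_ordE partner_neq ?ord_ltn_size.
Qed.

Lemma arc_in i : arc i \in M.
Proof. exact: imset_f. Qed.

Lemma mem_arc i : i \in arc i.
Proof. exact: set21. Qed.

Lemma arc_eq i j : i \in arc j -> arc i = arc j.
Proof. by rewrite !inE => /orP[]/eqP-> //; rewrite /arc partner_ordK setUC. Qed.

Lemma card_arc i : #|arc i| = 2.
Proof. by rewrite cards2 (eq_sym i) partner_ord_neq. Qed.

Lemma partition_matching_of : partition M [set: 'I_N].
Proof.
apply/and3P; split.
- rewrite eqEsubset subsetT; apply/subsetP => i _; apply/bigcupP.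
  by exists (arc i); rewrite ?arc_in ?mem_arc.
- apply/trivIsetP => _ _ /imsetP[i _ ->] /imsetP[j _ ->].
  apply: contraR => /pred0Pn[k].
  by case/andP => /= /arc_eq <- /arc_eq <-.
by apply/imsetP => -[i _ E]; have := mem_arc i; rewrite -E inE.
Qed.

Lemma pblock_matching_of i : pblock M i = arc i.
Proof.
have M_triv := partition_trivIset partition_matching_of.
by rewrite (def_pblock M_triv (arc_in i)) ?mem_arc.
Qed.

Lemma opens_opener i : i < N -> opens w (opener w i).
Proof.
rewrite -w_size => i_lt; have := partner_neq w_inv i_lt; rewrite /opens /opener.
by case: (ltngtP i (partner w i)) => [||->]; rewrite ?partnerK ?eqxx.
Qed.

Lemma opener_id i : opens w i -> opener w i = i.
Proof. by move=> /ltnW/minn_idPl. Qed.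

Lemma opener_partner i : i < N -> opener w (partner w i) = opener w i.
Proof. by move=> i_lt; rewrite /opener partnerK ?w_size // minnC. Qed.

Lemma opener_eq i j : i < j < N -> opener w i = opener w j -> partner w i = j.
Proof.
rewrite -w_size /opener => /andP[ij j_lt] E; have i_lt := ltn_trans ij j_lt.
have [ji|pij] : partner w j = i \/ partner w i = partner w j by lia.
  by rewrite -ji partnerK.
by move: ij; rewrite -(partnerK w_inv i_lt) pij partnerK // ltnn.
Qed.

Lemma canonical_form_ltn i j : i < N -> j < N ->
  (nth 0 (canonical_form M) i < nth 0 (canonical_form M) j) =
  (opener w i < opener w j).
Proof.
have cfE (k : 'I_N) : nth 0 (canonical_form M) k = edge_label M (arc k).
  by rewrite (nth_map k) ?size_enum_ord // nth_ord_enum pblock_matching_of.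
move=> i_lt j_lt; rewrite (cfE (Ordinal i_lt)) (cfE (Ordinal j_lt)).
by rewrite edge_label_ltn ?arc_in // !initial_point_set2 !partner_ordE.
Qed.

Lemma canonical_form_containsP tau : reflect
  (exists ps, [/\ sorted ltn ps, all (gtn N) ps &
                  order_isomorphic (map (opener w) ps) tau])
  (word_contains (canonical_form M) tau).
Proof.
have iso_opener ps : all (gtn N) ps ->
    order_isomorphic (map (nth 0 (canonical_form M)) ps) tau =
    order_isomorphic (map (opener w) ps) tau.
  move=> /allP ps_lt; apply: eq_in_order_isomorphic => i j /ps_lt i_lt /ps_lt.
  exact: canonical_form_ltn.
have size_cf : size (canonical_form M) = N by rewrite size_map size_enum_ord.
apply: (iffP (word_containsP _ _)); rewrite size_cf => -[ps [ps_sorted ps_lt]].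
  by rewrite iso_opener // => iso; exists ps.
by rewrite -iso_opener // => iso; exists ps.
Qed.

Lemma avoids_12312 : avoids M [:: 1; 2; 3; 1; 2] = ~~ contains12312 w.
Proof.
congr (~~ _); apply/canonical_form_containsP/contains12312P.
  case=> ps [ps_sorted ps_lt iso]; have [size_ps _] := order_isomorphicP _ _ iso.
  case: ps ps_sorted ps_lt iso size_ps => [|p1 [|p2 [|p3 [|p4 [|p5 []]]]]] //=.
  case/and5P=> l12 l23 l34 l45 _ /and5P[n1 n2 n3 n4 /andP[n5 _]].
  rewrite order_isomorphic_12312 => /and4P[/eqP o14 /eqP o25 o12 o23] _.
  have p1_p4 : partner w p1 = p4 by apply: opener_eq; lia.
  have p2_p5 : partner w p2 = p5 by apply: opener_eq; lia.
  (* The letter 3 may be read at the closer of its arc. *)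
  exists p1, p2, (opener w p3); split; last exact: opens_opener.
    by rewrite /crosses p1_p4 p2_p5; lia.
  by rewrite /opener in o23 *; lia.
case=> i [j [k [ij jk kO]]]; have /andP[iO jO] := crosses_opens ij.
have /and3P[ltij lti ltp] := ij; have /andP[ltjk ltki] := jk.
exists [:: i; j; k; partner w i; partner w j]; split.
- by rewrite /= ltij ltjk ltki ltp.
- by rewrite /= -w_size !partner_ltn ?opens_size.
rewrite /= order_isomorphic_12312 !opener_partner -?w_size ?opens_size //.
by rewrite !opener_id // !eqxx ltij.
Qed.

Lemma avoids_121323 : avoids M [:: 1; 2; 1; 3; 2; 3] = ~~ contains121323 w.
Proof.
congr (~~ _); apply/canonical_form_containsP/contains121323P.
  case=> ps [ps_sorted ps_lt iso]; have [size_ps _] := order_isomorphicP _ _ iso.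
  case: ps ps_sorted ps_lt iso size_ps => [|p1 [|p2 [|p3 [|p4 [|p5 [|p6 []]]]]]] //=.
  case/and5P=> l12 l23 l34 l45 /andP[l56 _].
  case/and5P=> n1 n2 n3 n4 /and3P[n5 n6 _].
  rewrite order_isomorphic_121323 => /and5P[/eqP o13 /eqP o25 /eqP o46 o12 o24] _.
  have p1_p3 : partner w p1 = p3 by apply: opener_eq; lia.
  have p2_p5 : partner w p2 = p5 by apply: opener_eq; lia.
  have p4_p6 : partner w p4 = p6 by apply: opener_eq; lia.
  by exists p1, p2, p4; rewrite /crosses p1_p3 p2_p5 p4_p6; split; lia.
case=> i [j [k [ij jk ik]]].
have /andP[iO jO] := crosses_opens ij; have /andP[_ kO] := crosses_opens jk.
have /and3P[ltij ltji _] := ij; have /and3P[ltjk ltkj ltp] := jk.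
exists [:: i; j; partner w i; k; partner w j; partner w k]; split.
- by rewrite /= ltij ltji ik ltkj ltp.
- by rewrite /= -w_size !partner_ltn ?opens_size.
rewrite /= order_isomorphic_121323 !opener_partner -?w_size ?opens_size //.
by rewrite !opener_id // !eqxx ltij.
Qed.

Lemma arc_of_set2 (i j : 'I_N) : [set i; j] \in M -> i != j ->
  [set i; j] = arc i /\ j = t i.
Proof.
case/imsetP=> k _ E ij; have i_k : i \in arc k by rewrite -E set21.
have j_i : j \in arc i by rewrite (arc_eq i_k) -E set22.
rewrite E -(arc_eq i_k); split=> //.
by move: j_i; rewrite !inE eq_sym (negbTE ij) => /eqP.
Qed.

Lemma opens_arc_inj (i j : 'I_N) :
  opens w i -> opens w j -> arc i = arc j -> i = j.
Proof.
move=> iO jO E; have := mem_arc i; rewrite E !inE => /orP[]/eqP // i_j.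
move: iO jO; rewrite /opens -!partner_ordE i_j partner_ordK; lia.
Qed.

Lemma crossing_arcP e f : e \in M -> f \in M -> reflect
  (exists i j : 'I_N, crosses w i j /\
     ((e = arc i /\ f = arc j) \/ (e = arc j /\ f = arc i)))
  (crossing e f).
Proof.
move=> eM fM; apply: (iffP existsP).
  case=> i /existsP[j /existsP[i' /existsP[j']]].
  case/and3P=> /eqP eE /eqP fE order; rewrite eE in eM *; rewrite fE in fM *.
  have [-> j_i] : [set i; j] = arc i /\ j = t i.
    by apply: arc_of_set2 => //; apply: contraTneq order => ->; lia.
  have [-> j'_i'] : [set i'; j'] = arc i' /\ j' = t i'.
    by apply: arc_of_set2 => //; apply: contraTneq order => ->; lia.
  move: order; rewrite j_i j'_i' !partner_ordE => /orP[order|order].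
    by exists i, i'; split; [|left].
  by exists i', i; split; [|right].
case=> i [j [ij [[-> ->]|[-> ->]]]].
  exists i; apply/existsP; exists (t i); apply/existsP; exists j; apply/existsP.
  by exists (t j); rewrite !eqxx !partner_ordE /=; apply/orP; left.
exists j; apply/existsP; exists (t j); apply/existsP; exists i; apply/existsP.
by exists (t i); rewrite !eqxx !partner_ordE /=; apply/orP; right.
Qed.

Lemma crossing_arcs_inj : {in [set x : 'I_N * 'I_N | crosses w x.1 x.2] &,
  injective (fun x : 'I_N * 'I_N => [set arc x.1; arc x.2])}.
Proof.
move=> [i j] [i' j']; rewrite !inE /= => ij ij' E.
have /andP[iO jO] := crosses_opens ij; have /andP[iO' jO'] := crosses_opens ij'.
have i_in : arc i \in [set arc i'; arc j'] by rewrite -E set21.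
have j_in : arc j \in [set arc i'; arc j'] by rewrite -E set22.
move: i_in j_in ij ij'; rewrite !inE /crosses.
by do 2![case/orP=> /eqP/opens_arc_inj-> //]; lia.
Qed.

Lemma crossing_numberE :
  crossing_number w = #|[set x : 'I_N * 'I_N | crosses w x.1 x.2]|.
Proof.
transitivity (\sum_(i < N) \sum_(j < N) (crosses w i j : nat)).
  rewrite /crossing_number w_size big_mkord.
  by apply: eq_bigr => i _; rewrite big_mkord.
rewrite pair_big -sum1_card [RHS]big_mkcond; apply: eq_bigr => x _.
by rewrite inE; case: (crosses _ _ _).
Qed.

Lemma crossings_matching_of : crossings M = crossing_number w.
Proof.
rewrite crossing_numberE -(card_in_imset crossing_arcs_inj).
apply: eq_card => P; rewrite inE; apply/exists_inP/imsetP.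
  case=> e eM /exists_inP[f fM /andP[/eqP->]].
  case/(crossing_arcP eM fM)=> i [j [ij ef]].
  by exists (i, j); rewrite ?inE //=; case: ef => -[-> ->] //; rewrite setUC.
case=> -[i j]; rewrite inE /= => ij ->; exists (arc i); rewrite ?arc_in //.
apply/exists_inP; exists (arc j); rewrite ?arc_in // eqxx /=.
by apply/crossing_arcP; rewrite ?arc_in //; exists i, j; split; [|left].
Qed.

End MatchingOf.

Lemma matching_of_inj N :
  {in [pred w | (size w == N) && is_partner_list w] &,
    injective (matching_of N)}.
Proof.
move=> v w; rewrite !inE => /andP[/eqP v_size v_inv] /andP[/eqP w_size w_inv] E.
apply: (@eq_from_nth _ 0) => [|i]; rewrite v_size // => i_lt.
have := pblock_matching_of v_size v_inv (Ordinal i_lt).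
rewrite E (pblock_matching_of w_size w_inv) => arcE.
have : partner_ord v (Ordinal i_lt) \in arc w (Ordinal i_lt).
  by rewrite arcE set22.
rewrite !inE (negbTE (partner_ord_neq v_size v_inv _)) => /eqP/(congr1 val) /=.
by rewrite !partner_ordE.
Qed.

Section PartnerListOf.

Variables (N : nat) (M : {set {set 'I_N}}).
Hypothesis M_part : partition M [set: 'I_N].
Hypothesis M_pairs : forall e, e \in M -> #|e| = 2.

Definition mate (i : 'I_N) : 'I_N := odflt i [pick j in pblock M i | j != i].

Definition partner_list_of : seq nat := [seq val (mate i) | i <- enum 'I_N].

Lemma pblock_in i : pblock M i \in M.
Proof. by rewrite pblock_mem // (cover_partition M_part) inE. Qed.

Lemma mem_own_pblock i : i \in pblock M i.
Proof. by rewrite mem_pblock (cover_partition M_part) inE. Qed.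

Lemma mateP i : pblock M i = [set i; mate i] /\ mate i != i.
Proof.
have /eqP/cards2P[x [y [xy E]]] := M_pairs (pblock_in i).
have [j ji Ej] : exists2 j, j != i & pblock M i = [set i; j].
  have := mem_own_pblock i; rewrite E !inE => /orP[]/eqP->.
    by exists y; rewrite // eq_sym.
  by exists x; rewrite // setUC.
rewrite /mate; case: pickP => [k /andP[+ ki]|/(_ j)]; last by rewrite Ej set22 ji.
by rewrite Ej !inE (negbTE ki) /= => /eqP->.
Qed.

Lemma mateK : involutive mate.
Proof.
move=> i; have [Ei ni] := mateP i; have [Em _] := mateP (mate i).
have same_block : pblock M (mate i) = pblock M i.
  by rewrite (def_pblock (partition_trivIset M_part) (pblock_in i)) // Ei set22.
have := mem_own_pblock i; rewrite -same_block Em !inE eq_sym (negbTE ni).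
by move/eqP.
Qed.

Lemma size_partner_list_of : size partner_list_of = N.
Proof. by rewrite size_map size_enum_ord. Qed.

Lemma nth_partner_list_of (i : 'I_N) : partner partner_list_of i = mate i.
Proof. by rewrite (nth_map i) ?size_enum_ord // nth_ord_enum. Qed.

Lemma is_partner_list_of : is_partner_list partner_list_of.
Proof.
apply/partner_listP => i; rewrite size_partner_list_of => i_lt.
rewrite (nth_partner_list_of (Ordinal i_lt)) nth_partner_list_of mateK; split=> //.
by have [_] := mateP (Ordinal i_lt).
Qed.

Lemma matching_of_partner_list_of : matching_of N partner_list_of = M.
Proof.
have arcE i : arc partner_list_of i = pblock M i.
  rewrite (mateP i).1; congr [set _; _]; apply: val_inj => /=.
  rewrite partner_ordE ?nth_partner_list_of ?size_partner_list_of //.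
  exact: is_partner_list_of.
apply/setP => e; apply/imsetP/idP => [[i _ ->]|eM].
  by rewrite arcE pblock_in.
have /set0Pn[i ie] : e != set0 by rewrite -card_gt0 (M_pairs eM).
by exists i; rewrite ?arcE // (def_pblock (partition_trivIset M_part) eM).
Qed.

End PartnerListOf.

Section CountMatchings.

Variable n : nat.

Local Notation matchings := (map (matching_of (2 * n)) (partner_lists n)).

Lemma uniq_matchings : uniq matchings.
Proof.
rewrite map_inj_in_uniq ?uniq_partner_lists // => v w.
by rewrite !mem_partner_lists; apply: matching_of_inj.
Qed.

Lemma mem_matchings M : (M \in matchings) = is_matching M.
Proof.
apply/mapP/andP => [[w]|[M_part /forall_inP M_pairs]].
  rewrite mem_partner_lists => /andP[/eqP w_size w_inv] ->.
  split; first exact: partition_matching_of.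
  by apply/forall_inP => _ /imsetP[i _ ->]; rewrite card_arc.
have {}M_pairs e : e \in M -> #|e| = 2 by move=> /M_pairs/eqP.
exists (partner_list_of M); last by rewrite matching_of_partner_list_of.
by rewrite mem_partner_lists size_partner_list_of eqxx is_partner_list_of.
Qed.

Lemma card_matchings (P : pred {set {set 'I_(2 * n)}}) :
  #|[set M | is_matching M && P M]| =
  count (P \o matching_of (2 * n)) (partner_lists n).
Proof.
rewrite -count_map -size_filter -(card_uniqP _) ?filter_uniq ?uniq_matchings //.
by apply: eq_card => M; rewrite !inE mem_filter mem_matchings andbC.
Qed.

Local Open Scope ring_scope.

Lemma card_avoiding_matchings m :
  #|[set M : {set {set 'I_(2 * n)}} |
       [&& is_matching M, avoids M [:: 1; 2; 3; 1; 2]%N,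
           avoids M [:: 1; 2; 1; 3; 2; 3]%N & crossings M == m]]|%:R =
  (descendants n 1)`_m.
Proof.
rewrite -count_avoiders card_matchings; congr _%:R; apply: eq_in_count => w.
rewrite mem_partner_lists => /andP[/eqP w_size w_inv] /=.
by rewrite avoids_12312 // avoids_121323 // crossings_matching_of // andbA.
Qed.

End CountMatchings.

Local Open Scope ring_scope.

Theorem theorem3 (n m : nat) (hn : (1 <= n)%N) :
  #|[set M : {set {set 'I_(2 * n)}} |
       [&& is_matching M,
           avoids M [:: 1; 2; 3; 1; 2]%N,
           avoids M [:: 1; 2; 1; 3; 2; 3]%N &
           crossings M == m]]|%:R
  = 1 / n%:R * ('C(n, m))%:R * ('C(2 * n - m, n + 1))%:R :> rat.
Proof.
have := coef_descendants1 n m.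
rewrite -card_avoiding_matchings -natrM => /eqP.
rewrite eqr_nat => /eqP mul_card.
rewrite -mulrA -natrM addn1 -mul_card natrM div1r mulKf //.
by rewrite pnatr_eq0 -lt0n.
Qed.
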